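(* Let $(S,+,\ast)$ be an Ehresmann semigroupoid with set of projections $U$, and let $C(S)$ be its associated local biordered Ehresmann category. The following conditions are equivalent: (a) $S$ is a semigroup (that is, $S^{(2)}=S\times S$); (b) $U$ is a meet-semilattice; (c) $C(S)$ is a biordered Ehresmann category.
   Context: **Semigroupoid.** A semigroupoid is a triple $(S,S^{(2)},\star)$ with $S$ a set, $S^{(2)}\subseteq S\times S$ and $\star\colon S^{(2)}\to S$ such that for all $s,t,r\in S$: if either ($(s,t),(t,r)\in S^{(2)}$), or ($(s,t),(s\star t,r)\in S^{(2)}$), or ($(t,r),(s,t\star r)\in S^{(2)}$), then all of $(s,t),(t,r),(s\star t,r),(s,t\star r)$ lie in $S^{(2)}$ and $(s\star t)\star r=s\star(t\star r)$. Write $st=s\star t$; ''$st$ is defined'' means $(s,t)\in S^{(2)}$. **Ehresmann semigroupoid (two-sided).** A triple $(S,+,\ast)$ with $S$ a semigroupoid and unary operations $s\mapsto s^+$, $s\mapsto s^\ast$ on $S$ such that for all $s,t\in S$: (i) $s^+s$ and $ss^\ast$ are defined, $s^+s=s$ and $ss^\ast=s$; (ii) if $s^+t^+$ is defined, then $t^+s^+$ is defined and $s^+t^+=t^+s^+$; if $s^\ast t^\ast$ is defined, then $t^\ast s^\ast$ is defined and $s^\ast t^\ast=t^\ast s^\ast$; (iii) if $s^+t^+$ is defined, then $s^+t^+=(s^+t)^+$; if $s^\ast t^\ast$ is defined, then $s^\ast t^\ast=(st^\ast)^\ast$; (iv) if $st$ is defined, then $(st)^+=(st^+)^+$ and $(st)^\ast=(s^\ast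 t)^\ast$; (v) $s^+=(s^+)^\ast$ and $s^\ast=(s^\ast)^+$. (The products on the right-hand sides in (iii), (iv) are automatically defined.) Its set of projections is $U=\{s^+:s\in S\}=\{s^\ast:s\in S\}$. **Category.** A (small) category consists of sets $\mathcal{C}_0\subseteq\mathcal{C}$, maps $D,R\colon\mathcal{C}\to\mathcal{C}_0$ and a partial operation $\circ$ on $\mathcal{C}$, with $x\circ y$ defined iff $D(x)=R(y)$, such that: $D(x\circ y)=D(y)$ and $R(x\circ y)=R(x)$; $\circ$ is associative on composable triples; for $e\in\mathcal{C}_0$, $D(e)=e=R(e)$, and $x\circ e=x$, $e\circ y=y$ whenever $D(x)=e=R(y)$. **Local meet-semilattice.** A semigroupoid $X$ such that for every $e\in X$, $ee$ is defined and $ee=e$, and whenever $ef$ is defined, $fe$ is defined and $ef=fe$. Its partial order is: $e\leq f$ iff $ef$ is defined and $ef=e$. The operation is denoted $\wedge$ and is determined by $\leq$; a poset $(X,\le)$ is called a local meet-semilattice if $\le$ arises this way. A local meet-semilattice that is a semigroup (its operation is defined on all pairs) is simply called a meet-semilattice. For an Ehresmann semigroupoid $S$, the set $U$ with the composition of $S$ restricted to $(U\times U)\cap S^{(2)}$ is a local meet-semilattice. **Ordered category.** $(\mathcal{C},\leq)$ with $\mathcal{C}$ a category and $\leq$ a partial order on $\mathcal{C}$ such that: $x\leq y$ implies $D(x)\leq D(y)$ and $R(x)\leq R(y)$; if $x\leq y$, $x'\leq y'$ and $x\circ x'$, $y\circ y'$ are defined, then $x\circ x'\leq y\circ y'$.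 It has restrictions if for each $x\in\mathcal{C}$ and $e\in\mathcal{C}_0$ with $e\leq D(x)$ there is a unique $x|e\in\mathcal{C}$ with $x|e\leq x$ and $D(x|e)=e$. It has corestrictions if for each $x\in\mathcal{C}$ and $e\in\mathcal{C}_0$ with $e\leq R(x)$ there is a unique $e|x\in\mathcal{C}$ with $e|x\leq x$ and $R(e|x)=e$. **Local biordered Ehresmann category.** A triple $(\mathcal{C},\leq_l,\leq_r)$ with $\mathcal{C}$ a category such that: (1) $(\mathcal{C},\leq_l)$ is an ordered category with corestrictions; (2) $(\mathcal{C},\leq_r)$ is an ordered category with restrictions; (3) $\mathcal{C}_0$ is a local meet-semilattice with partial order $\leq$ and operation $\wedge$; (4) $\leq_l$ and $\leq_r$ both restrict to $\leq$ on $\mathcal{C}_0$; (5) $\leq_l\circ\leq_r$ and $\leq_r\circ\leq_l$ coincide as relations on $\mathcal{C}$, where $x\,(P\circ Q)\,y$ iff there is $z$ with $x\,P\,z$ and $z\,Q\,y$; (6) if $x\leq_l y$, $e\in\mathcal{C}_0$ and $D(x)\wedge e$ is defined, then $x|(D(x)\wedge e)\leq_l y|(D(y)\wedge e)$; (7) if $x\leq_r y$, $e\in\mathcal{C}_0$ and $e\wedge R(x)$ is defined, then $(e\wedge R(x))|x\leq_r(e\wedge R(y))|y$. A **biordered Ehresmann category** is a local biordered Ehresmann category such that $\mathcal{C}_0$ is a meet-semilattice. **Construction $C(S)$.** For an Ehresmann semigroupoid $(S,+,\ast)$ with projections $U$: $C(S)=S$ as a set, $C(S)_0=U$ (with $e\wedge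 f=ef$ whenever $ef$ is defined), $D(s)=s^\ast$, $R(s)=s^+$, $s\cdot t=st$ defined exactly when $s^\ast=t^+$; $s\leq_l t$ iff $s^+t$ is defined and $s^+t=s$; $s\leq_r t$ iff $ts^\ast$ is defined and $ts^\ast=s$. This is a local biordered Ehresmann category. *)

(* Defs.v *)
From mathcomp Require Import all_boot.
From mathcomp Require Import boolp classical_sets.

Set Implicit Arguments.
Unset Strict Implicit.
Unset Printing Implicit Defensive.

Local Open Scope classical_set_scope.

(* [op s t = Some u] reads "st is defined and st = u", so that S^(2) is the
   set of the pairs (s, t) with [defined_op op s t]. *)
Definition partial_op (T : Type) := T -> T -> option T.

Definition defined_op T (op : partial_op T) (s t : T) : Prop :=
  exists u, op s t = Some u.

Definition total_op T (op : partial_op T) : Prop :=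
  forall s t, defined_op op s t.

Definition is_semigroupoid T (op : partial_op T) : Prop :=
  forall s t r,
    [\/ defined_op op s t /\ defined_op op t r,
        exists2 st, op s t = Some st & defined_op op st r |
        exists2 tr, op t r = Some tr & defined_op op s tr] ->
    exists st tr u, [/\ op s t = Some st, op t r = Some tr,
                        op st r = Some u & op s tr = Some u].

Definition is_semigroup T (op : partial_op T) : Prop :=
  is_semigroupoid op /\ total_op op.

Record is_local_meet_semilattice T (op : partial_op T) : Prop := {
  lms_semigroupoid : is_semigroupoid op;
  lms_idem : forall e, op e e = Some e;
  lms_comm : forall e f, defined_op op e f -> op f e = op e f }.

Definition is_meet_semilattice T (op : partial_op T) : Prop :=
  is_local_meet_semilattice op /\ is_semigroup op.

Definition lms_le T (op : partial_op T) (e f : T) : Prop := op e f = Some e.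

(* A product that falls outside A counts as undefined in the restriction;
   for the projections of an Ehresmann semigroupoid this never happens, see
   [val_proj_op] below. *)
Definition restrict_op T (A : set T) (op : partial_op T) : partial_op A :=
  fun e f => obind insub (op (val e) (val f)).

(* In [plus_plus] to [star_mul], that the product u is defined is not an extra
   requirement: it follows from the other axioms. *)
Record ehresmann_semigroupoid := EhresmannSemigroupoid {
  ehr_sort :> Type;
  ehr_mul : partial_op ehr_sort;
  ehr_plus : ehr_sort -> ehr_sort;
  ehr_star : ehr_sort -> ehr_sort;
  mul_semigroupoid : is_semigroupoid ehr_mul;
  mul_plus : forall s, ehr_mul (ehr_plus s) s = Some s;
  mul_star : forall s, ehr_mul s (ehr_star s) = Some s;
  ehr_plusC : forall s t, defined_op ehr_mul (ehr_plus s) (ehr_plus t) ->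
    defined_op ehr_mul (ehr_plus t) (ehr_plus s) /\
    ehr_mul (ehr_plus s) (ehr_plus t) = ehr_mul (ehr_plus t) (ehr_plus s);
  ehr_starC : forall s t, defined_op ehr_mul (ehr_star s) (ehr_star t) ->
    defined_op ehr_mul (ehr_star t) (ehr_star s) /\
    ehr_mul (ehr_star s) (ehr_star t) = ehr_mul (ehr_star t) (ehr_star s);
  plus_plus : forall s t, defined_op ehr_mul (ehr_plus s) (ehr_plus t) ->
    exists2 u, ehr_mul (ehr_plus s) t = Some u &
      ehr_mul (ehr_plus s) (ehr_plus t) = Some (ehr_plus u);
  star_star : forall s t, defined_op ehr_mul (ehr_star s) (ehr_star t) ->
    exists2 u, ehr_mul s (ehr_star t) = Some u &
      ehr_mul (ehr_star s) (ehr_star t) = Some (ehr_star u);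
  plus_mul : forall s t st, ehr_mul s t = Some st ->
    exists2 u, ehr_mul s (ehr_plus t) = Some u & ehr_plus st = ehr_plus u;
  star_mul : forall s t st, ehr_mul s t = Some st ->
    exists2 u, ehr_mul (ehr_star s) t = Some u & ehr_star st = ehr_star u;
  ehr_plusE : forall s, ehr_plus s = ehr_star (ehr_plus s);
  ehr_starE : forall s, ehr_star s = ehr_plus (ehr_star s) }.

Definition ehr_proj (S : ehresmann_semigroupoid) : set S := range (@ehr_plus S).

Arguments ehr_proj : clear implicits.

Definition ehr_proj_op (S : ehresmann_semigroupoid) : partial_op (ehr_proj S) :=
  @restrict_op S (ehr_proj S) (@ehr_mul S).

Lemma range_star (S : ehresmann_semigroupoid) :
  range (@ehr_star S) = ehr_proj S.
Proof.
apply/seteqP; split=> _ [s _ <-].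
  by exists (ehr_star s) => //; rewrite -ehr_starE.
by exists (ehr_plus s) => //; rewrite -ehr_plusE.
Qed.

Lemma plus_proj (S : ehresmann_semigroupoid) (s : S) :
  ehr_plus s \in ehr_proj S.
Proof. by apply/mem_set; exists s. Qed.

Lemma star_proj (S : ehresmann_semigroupoid) (s : S) :
  ehr_star s \in ehr_proj S.
Proof. by apply/mem_set; rewrite -range_star; exists s. Qed.

Lemma val_proj_op (S : ehresmann_semigroupoid) (e f : ehr_proj S) :
  omap val (ehr_proj_op e f) = ehr_mul (val e) (val f).
Proof.
rewrite /ehr_proj_op /restrict_op.
case E: (ehr_mul (val e) (val f)) => [u|//] /=.
suff hu : u \in ehr_proj S by rewrite insubT.
have [s _ es] := set_valP e; have [t _ et] := set_valP f.
move: E; rewrite -es -et => E.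
have [v _ E'] := plus_plus (ex_intro _ u E).
by move: E'; rewrite E => -[->]; exact: plus_proj.
Qed.

Record category_data := CategoryData {
  cat_mor :> Type;
  cat_obj : set cat_mor;
  cat_dom : cat_mor -> cat_obj;
  cat_cod : cat_mor -> cat_obj;
  cat_comp : partial_op cat_mor }.

Arguments cat_obj : clear implicits.

Record is_category (C : category_data) : Prop := {
  comp_defined : forall x y : C,
    defined_op (@cat_comp C) x y <-> cat_dom x = cat_cod y;
  dom_comp : forall x y z : C, cat_comp x y = Some z -> cat_dom z = cat_dom y;
  cod_comp : forall x y z : C, cat_comp x y = Some z -> cat_cod z = cat_cod x;
  compA : forall x y z xy yz : C,
    cat_comp x y = Some xy -> cat_comp y z = Some yz ->
    cat_comp xy z = cat_comp x yz;
  dom_obj : forall e : cat_obj C, cat_dom (val e) = e;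
  cod_obj : forall e : cat_obj C, cat_cod (val e) = e;
  comp1r : forall (x : C) (e : cat_obj C), cat_dom x = e ->
    cat_comp x (val e) = Some x;
  comp1l : forall (y : C) (e : cat_obj C), cat_cod y = e ->
    cat_comp (val e) y = Some y }.

Record is_partial_order T (le : T -> T -> Prop) : Prop := {
  po_refl : forall x, le x x;
  po_anti : forall x y, le x y -> le y x -> x = y;
  po_trans : forall x y z, le x y -> le y z -> le x z }.

Record is_ordered_category (C : category_data) (le : C -> C -> Prop) : Prop := {
  oc_category : is_category C;
  oc_order : is_partial_order le;
  oc_dom : forall x y, le x y -> le (val (cat_dom x)) (val (cat_dom y));
  oc_cod : forall x y, le x y -> le (val (cat_cod x)) (val (cat_cod y));
  oc_comp : forall x y x' y' z w, le x y -> le x' y' ->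
    cat_comp x x' = Some z -> cat_comp y y' = Some w -> le z w }.

(* "z is x|e" *)
Definition is_restriction (C : category_data) (le : C -> C -> Prop)
    (x : C) (e : cat_obj C) (z : C) : Prop :=
  le z x /\ cat_dom z = e.

(* "z is e|x" *)
Definition is_corestriction (C : category_data) (le : C -> C -> Prop)
    (e : cat_obj C) (x : C) (z : C) : Prop :=
  le z x /\ cat_cod z = e.

Definition has_restrictions (C : category_data) (le : C -> C -> Prop) : Prop :=
  forall (x : C) (e : cat_obj C), le (val e) (val (cat_dom x)) ->
    exists! z, is_restriction le x e z.

Definition has_corestrictions (C : category_data) (le : C -> C -> Prop)
    : Prop :=
  forall (x : C) (e : cat_obj C), le (val e) (val (cat_cod x)) ->
    exists! z, is_corestriction le e x z.

Definition rel_comp T (P Q : T -> T -> Prop) (x y : T) : Prop :=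
  exists2 z, P x z & Q z y.

(* The meet operation of C_0 is listed along with the two orders, although it
   is determined by either of them. In the last two axioms, the definedness of
   the second meet and of both (co)restrictions follows from the other axioms. *)
Record is_local_biordered_ehresmann_category (C : category_data)
    (lel ler : C -> C -> Prop) (meet : partial_op (cat_obj C)) : Prop := {
  lbe_lel : is_ordered_category lel;
  lbe_lel_corestr : has_corestrictions lel;
  lbe_ler : is_ordered_category ler;
  lbe_ler_restr : has_restrictions ler;
  lbe_meet : is_local_meet_semilattice meet;
  lbe_lel_obj : forall e f : cat_obj C, lel (val e) (val f) <-> lms_le meet e f;
  lbe_ler_obj : forall e f : cat_obj C, ler (val e) (val f) <-> lms_le meet e f;
  lbe_comm : forall x y, rel_comp lel ler x y <-> rel_comp ler lel x y;
  lbe_lel_meet : forall (x y : C) (e d : cat_obj C),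
    lel x y -> meet (cat_dom x) e = Some d ->
    exists d' x' y', [/\ meet (cat_dom y) e = Some d',
      is_restriction ler x d x', is_restriction ler y d' y' & lel x' y'];
  lbe_ler_meet : forall (x y : C) (e d : cat_obj C),
    ler x y -> meet e (cat_cod x) = Some d ->
    exists d' x' y', [/\ meet e (cat_cod y) = Some d',
      is_corestriction lel d x x', is_corestriction lel d' y y' & ler x' y'] }.

Definition is_biordered_ehresmann_category (C : category_data)
    (lel ler : C -> C -> Prop) (meet : partial_op (cat_obj C)) : Prop :=
  is_local_biordered_ehresmann_category lel ler meet /\
  is_meet_semilattice meet.

Definition cat_of (S : ehresmann_semigroupoid) : category_data := {|
  cat_mor := S;
  cat_obj := ehr_proj S;
  cat_dom := fun s => SigSub (star_proj s);
  cat_cod := fun s => SigSub (plus_proj s);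
  cat_comp := fun s t => if `[< ehr_star s = ehr_plus t >] then ehr_mul s t
                        else None |}.

Definition cat_lel (S : ehresmann_semigroupoid) (s t : cat_of S) : Prop :=
  ehr_mul (ehr_plus s) t = Some s.

Definition cat_ler (S : ehresmann_semigroupoid) (s t : cat_of S) : Prop :=
  ehr_mul t (ehr_star s) = Some s.

Definition cat_meet (S : ehresmann_semigroupoid) :
  partial_op (cat_obj (cat_of S)) := @ehr_proj_op S.

(* Main.v *)
From mathcomp Require Import all_boot.
From mathcomp Require Import boolp classical_sets.
Require Import Defs.

Set Implicit Arguments.
Unset Strict Implicit.
Unset Printing Implicit Defensive.

(** The equivalence of (a) and (b) is short: [t^+ t = t] and [s s^* = s], so in
    a semigroupoid [s t] is defined as soon as the product [s^* t^+] of two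
    projections is; hence the product of S is total when that of U is
    ([total_of_proj]).  As (c) consists of (b) and the fact that C(S) is a local
    biordered Ehresmann category, the rest of the proof is that fact
    ([local_biordered]), which holds for every Ehresmann semigroupoid.

    Two devices keep it short.  First, adjoining a zero [None] to S, as the
    value of the undefined products, turns S into an associative structure in
    which all Ehresmann identities hold unconditionally: in each identity, one
    side is defined exactly when the other is.  Partial computations thus become
    plain rewriting ([zmulA], [zplusK], [zplusC], [zplusM], [zplus_mul] and the
    star versions), and the only remaining trace of definedness is
    [zmul_neq0]: if xy and yz are nonzero, so is xyz.

    Second, reversing the product and exchanging plus and star gives again an
    Ehresmann semigroupoid [dual S], whose category is opposite to C(S) and
    whose order [cat_lel] is convertible to the order [cat_ler] of S.  Each
    axiom on [cat_ler] therefore comes from the corresponding axiom on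
    [cat_lel] in the dual.

    The axioms themselves rest on the remark that [x <=_l y] as soon as
    [x = e y] for some projection e ([zlel_mul]); the corestriction [e|x] is
    the product [e x], and both composites of the two orders relate [e y f]
    to y. *)

(** * Adjoining a zero *)

Definition zmul (S : ehresmann_semigroupoid) (x y : option S) : option S :=
  obind (fun s => obind (ehr_mul s) y) x.

Definition zplus (S : ehresmann_semigroupoid) (x : option S) : option S :=
  omap (@ehr_plus S) x.

Definition zstar (S : ehresmann_semigroupoid) (x : option S) : option S :=
  omap (@ehr_star S) x.

Local Notation "x ** y" := (zmul x y) (at level 40, left associativity).

Lemma zmul0r (S : ehresmann_semigroupoid) (x : option S) : x ** None = None.
Proof. by case: x. Qed.

Lemma definedP (S : ehresmann_semigroupoid) (s t : S) :
  defined_op (@ehr_mul S) s t <-> Some s ** Some t <> None.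
Proof.
split=> [[u /= ->]//|] /=.
by rewrite /defined_op; case: ehr_mul => // u _; exists u.
Qed.

Lemma zmulA (S : ehresmann_semigroupoid) (x y z : option S) :
  x ** y ** z = x ** (y ** z).
Proof.
case: x y z => [s|] [t|] [r|] //=; rewrite ?zmul0r //.
have H := @mul_semigroupoid S s t r.
case E: (ehr_mul s t) => [st|] /=.
  case F: (ehr_mul st r) => [u|].
    have [|st' [tr [v []]]] := H.
      by apply: Or32; exists st => //; exists u.
    by rewrite E => -[<-] -> /=; rewrite F => -[->] ->.
  case G: (ehr_mul t r) => [tr|] //=.
  have [|st' [tr' [v []]]] := H.
    by apply: Or31; split; [exists st|exists tr].
  by rewrite E => -[<-] _; rewrite F.
case G: (ehr_mul t r) => [tr|] //=.
case F: (ehr_mul s tr) => [u|] //.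
have [|st' [tr' [v []]]] := H; last by rewrite E.
by apply: Or33; exists tr => //; exists u.
Qed.

Lemma zmul_neq0 (S : ehresmann_semigroupoid) (x y z : option S) :
  x ** y <> None -> y ** z <> None -> x ** y ** z <> None.
Proof.
case: x y z => [s|] [t|] [r|] //; rewrite ?zmul0r //.
move=> /definedP st /definedP tr /=.
have [|a [b [u [-> _ E _]]]] := @mul_semigroupoid S s t r; first exact: Or31.
by rewrite /= E.
Qed.

Lemma zmul_some (S : ehresmann_semigroupoid) (x : option S) :
  x <> None -> exists s, x = Some s.
Proof. by case: x => // s _; exists s. Qed.

(** * Duality *)

Lemma dual_semigroupoid (S : ehresmann_semigroupoid) :
  is_semigroupoid (fun s t : S => ehr_mul t s).
Proof.
move=> s t r H; have [|rt [ts [u [? ? ? ?]]]] := @mul_semigroupoid S r t s.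
  by case: H => [[? ?]|H|H]; [exact: Or31|exact: Or33|exact: Or32].
by exists ts, rt, u.
Qed.

Lemma dual_starC (S : ehresmann_semigroupoid) (s t : S) :
  defined_op (fun s t : S => ehr_mul t s) (ehr_star s) (ehr_star t) ->
  defined_op (fun s t : S => ehr_mul t s) (ehr_star t) (ehr_star s) /\
  ehr_mul (ehr_star t) (ehr_star s) = ehr_mul (ehr_star s) (ehr_star t).
Proof. exact: ehr_starC. Qed.

Lemma dual_plusC (S : ehresmann_semigroupoid) (s t : S) :
  defined_op (fun s t : S => ehr_mul t s) (ehr_plus s) (ehr_plus t) ->
  defined_op (fun s t : S => ehr_mul t s) (ehr_plus t) (ehr_plus s) /\
  ehr_mul (ehr_plus t) (ehr_plus s) = ehr_mul (ehr_plus s) (ehr_plus t).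
Proof. exact: ehr_plusC. Qed.

Definition dual (S : ehresmann_semigroupoid) : ehresmann_semigroupoid :=
  @EhresmannSemigroupoid S (fun s t => ehr_mul t s) (@ehr_star S) (@ehr_plus S)
    (@dual_semigroupoid S) (@mul_star S) (@mul_plus S)
    (@dual_starC S) (@dual_plusC S)
    (fun s t => @star_star S t s) (fun s t => @plus_plus S t s)
    (fun s t => @star_mul S t s) (fun s t => @plus_mul S t s)
    (@ehr_starE S) (@ehr_plusE S).

Lemma zmul_dual (S : ehresmann_semigroupoid) (x y : option S) :
  @zmul (dual S) x y = @zmul S y x.
Proof. by case: x y => [s|] [t|]. Qed.

(** * The Ehresmann identities with a zero *)

Lemma zplusK (S : ehresmann_semigroupoid) (x : option S) : zplus x ** x = x.
Proof. by case: x => //= s; exact: mul_plus. Qed.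

Lemma zplusC (S : ehresmann_semigroupoid) (x y : option S) :
  zplus x ** zplus y = zplus y ** zplus x.
Proof.
case: x y => [s|] [t|] //=.
have H := @ehr_plusC S s t; have H' := @ehr_plusC S t s.
case E: (ehr_mul (ehr_plus s) (ehr_plus t)) => [u|].
  by rewrite -E; apply: (H _).2; exists u.
case F: (ehr_mul (ehr_plus t) (ehr_plus s)) => [u|] //.
by rewrite -E -F; symmetry; apply: (H' _).2; exists u.
Qed.

(** If [s^+ t] is defined, then so is [s^+ t^+], because [t = t^+ t]. *)
Lemma zplusM (S : ehresmann_semigroupoid) (x y : option S) :
  zplus (zplus x ** y) = zplus x ** zplus y.
Proof.
case: x y => [s|] [t|] //=.
case E: (ehr_mul (ehr_plus s) (ehr_plus t)) => [u|].
  have [|v -> F] := @plus_plus S s t; first by exists u.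
  by rewrite -E F.
case F: (ehr_mul (ehr_plus s) t) => [u|] //.
by have [v] := plus_mul F; rewrite E.
Qed.

(** If [s t^+] is defined, then so is [s t^+ t = s t]. *)
Lemma zplus_mul (S : ehresmann_semigroupoid) (x y : option S) :
  zplus (x ** y) = zplus (x ** zplus y).
Proof.
case E: (x ** y) => [u|]; first by
  case: x y E => [s|] [t|] //= /plus_mul[v -> ->].
case F: (x ** zplus y) => [v|] //; exfalso.
have := @zmul_neq0 S x (zplus y) y.
by rewrite zmulA zplusK E F; apply=> // y0; move: F; rewrite y0 zmul0r.
Qed.

Lemma zplus_star (S : ehresmann_semigroupoid) (x : option S) :
  zstar (zplus x) = zplus x.
Proof. by case: x => //= s; rewrite -ehr_plusE. Qed.

Lemma zstarK (S : ehresmann_semigroupoid) (x : option S) : x ** zstar x = x.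
Proof. by rewrite -zmul_dual; exact: (@zplusK (dual S)). Qed.

Lemma zstarM (S : ehresmann_semigroupoid) (x y : option S) :
  zstar (x ** zstar y) = zstar x ** zstar y.
Proof. by rewrite -!(@zmul_dual S); exact: (@zplusM (dual S)). Qed.

Lemma zstar_plus (S : ehresmann_semigroupoid) (x : option S) :
  zplus (zstar x) = zstar x.
Proof. exact: (@zplus_star (dual S)). Qed.

Lemma zplus_id (S : ehresmann_semigroupoid) (x : option S) :
  zplus (zplus x) = zplus x.
Proof. by rewrite -[in LHS](zplus_star x) zstar_plus zplus_star. Qed.

(** * The left order *)

(** For projections e, [e y] lies below y, which gives the left order the more
    flexible form: [x <=_l y] iff [x = e y] for some projection e. *)
Lemma zlel_mul (S : ehresmann_semigroupoid) (a y : option S) :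
  zplus (zplus a ** y) ** y = zplus a ** y.
Proof. by rewrite zplusM zmulA zplusK. Qed.

Lemma lelE (S : ehresmann_semigroupoid) (s t : S) :
  cat_lel s t <-> exists a, Some s = zplus a ** Some t.
Proof.
split=> [st|[a E]]; first by exists (Some s).
have := zlel_mul a (Some t); rewrite -E; exact.
Qed.

Lemma zlel_anti (S : ehresmann_semigroupoid) (x y : option S) :
  zplus x ** y = x -> zplus y ** x = y -> x = y.
Proof.
by move=> xy yx; rewrite -{1}xy -{1}yx -zmulA zplusC zmulA zplusK.
Qed.

Lemma lel_partial_order (S : ehresmann_semigroupoid) :
  is_partial_order (@cat_lel S).
Proof.
split=> [s|s t|s t r].
- exact: mul_plus.
- move=> st ts; exact: (Some_inj (@zlel_anti S (Some s) (Some t) st ts)).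
move=> st /lelE[a E]; apply/lelE; exists (zplus (Some s) ** zplus a).
by rewrite zplusM zplus_id zmulA -E.
Qed.

(** Below x, the left order is determined by the range: [e|x = e x]. *)
Lemma lel_corestriction (S : ehresmann_semigroupoid) (e x : S) :
  ehr_plus e = e -> ehr_mul e (ehr_plus x) = Some e ->
  exists z, [/\ ehr_mul e x = Some z, cat_lel z x & ehr_plus z = e].
Proof.
move=> pe ex; have [|u E F] := @plus_plus S e x.
  by exists e; rewrite pe.
exists u; rewrite -pe; split=> //; last first.
  by move: F; rewrite pe ex => -[<-].
by apply/lelE; exists (Some e).
Qed.

Lemma lel_corestriction_uniq (S : ehresmann_semigroupoid) (x z z' : S) :
  cat_lel z x -> cat_lel z' x -> ehr_plus z = ehr_plus z' -> z = z'.
Proof. by rewrite /cat_lel => E E' F; move: E; rewrite F E' => -[]. Qed.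

Lemma lel_plus (S : ehresmann_semigroupoid) (s t : S) :
  cat_lel s t -> cat_lel (ehr_plus s) (ehr_plus t).
Proof.
move=> st; have {}st : zplus (Some s) ** Some t = Some s := st.
have E : zplus (zplus (Some s)) ** zplus (Some t) = zplus (Some s).
  by rewrite zplus_id -zplusM st.
exact: E.
Qed.

Lemma lel_star (S : ehresmann_semigroupoid) (s t : S) :
  cat_lel s t -> zstar (Some s) ** zstar (Some t) = zstar (Some s).
Proof.
move=> st; have {}st : zplus (Some s) ** Some t = Some s := st.
by rewrite -zstarM -{1}st zmulA zstarK st.
Qed.

Lemma lel_star_le (S : ehresmann_semigroupoid) (s t : S) :
  cat_lel s t -> cat_lel (ehr_star s) (ehr_star t).
Proof.
move=> /lel_star E.
have F : zplus (zstar (Some s)) ** zstar (Some t) = zstar (Some s).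
  by rewrite zstar_plus.
exact: F.
Qed.

Lemma lel_comp (S : ehresmann_semigroupoid) (x y x' y' z w : S) :
  cat_lel x y -> cat_lel x' y' -> ehr_star x = ehr_plus x' ->
  ehr_mul x x' = Some z -> ehr_mul y y' = Some w -> cat_lel z w.
Proof.
move=> xy x'y' D zE wE; apply/lelE; exists (Some x).
have {}xy : zplus (Some x) ** Some y = Some x := xy.
have {}x'y' : zplus (Some x') ** Some y' = Some x' := x'y'.
have {}D : zstar (Some x) = zplus (Some x') by rewrite /= D.
have {}zE : Some x ** Some x' = Some z := zE.
have {}wE : Some y ** Some y' = Some w := wE.
by rewrite -zE -wE -x'y' -D -!zmulA zstarK xy.
Qed.

(** The right order interacts with the left one through [(e y) f = e (y f)]. *)
Lemma lel_ler_comm (S : ehresmann_semigroupoid) (x y : S) :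
  rel_comp (@cat_lel S) (@cat_ler S) x y ->
  rel_comp (@cat_ler S) (@cat_lel S) x y.
Proof.
move=> [z xz zy].
have {}xz : zplus (Some x) ** Some z = Some x := xz.
have {}zy : Some y ** zstar (Some z) = Some z := zy.
have E : zplus (Some x) ** Some y ** zstar (Some z) = Some x.
  by rewrite zmulA zy.
have [|w wE] := @zmul_some S (zplus (Some x) ** Some y).
  by move=> N; rewrite N in E.
exists w; last by apply/lelE; exists (Some x).
(* In the dual, [cat_ler] is [cat_lel] and [lelE] characterises it. *)
apply/(@lelE (dual S)); exists (Some z).
by rewrite zmul_dual -wE E.
Qed.

(** Since [x^* <= y^*], the product [x^* e = x^* (y^* e)] can only be defined
    when [y^* e] is. *)
Lemma lel_meet (S : ehresmann_semigroupoid) (x y e d : S) :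
  ehr_star e = e -> cat_lel x y -> ehr_mul (ehr_star x) e = Some d ->
  exists d' x' y', [/\ ehr_mul (ehr_star y) e = Some d',
    cat_ler x' x /\ ehr_star x' = d, cat_ler y' y /\ ehr_star y' = d' &
    cat_lel x' y'].
Proof.
move=> pe xy dE.
(* the restriction [s|(s^* e)] is [s e] *)
have R s c : ehr_mul (ehr_star s) e = Some c -> exists s',
    [/\ Some s ** Some e = Some s', cat_ler s' s & ehr_star s' = c].
  move=> cE; have {}cE : zstar (Some s) ** zstar (Some e) = Some c.
    by rewrite /= pe.
  have eE : Some e = zstar (Some e) by rewrite /= pe.
  have [|s' s'E] := @zmul_some S (Some s ** Some e).
    by move=> N; move: cE; rewrite -zstarM -eE N.
  exists s'; split=> //; last first.
    have : zstar (Some s') = Some c by rewrite -s'E eE zstarM.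
    by case.
  apply/(@lelE (dual S)); exists (Some e).
  by rewrite zmul_dual -s'E {1}eE.
have [d' d'E] : exists d', ehr_mul (ehr_star y) e = Some d'.
  apply: (@zmul_some S (zstar (Some y) ** Some e)) => N.
  have : zstar (Some x) ** Some e = None.
    by rewrite -(lel_star xy) zmulA N zmul0r.
  by rewrite /= dE.
have [x' [x'E x'x x'd]] := R _ _ dE; have [y' [y'E y'y y'd]] := R _ _ d'E.
exists d', x', y'; split=> //; apply/lelE; exists (Some x).
have {}xy : zplus (Some x) ** Some y = Some x := xy.
by rewrite -y'E -zmulA xy x'E.
Qed.

(** * The meet operation on projections *)

Lemma proj_plus (S : ehresmann_semigroupoid) (e : ehr_proj S) :
  ehr_plus (val e) = val e.
Proof.
by have [s _ <-] := set_valP e; apply: (Some_inj (zplus_id (Some s))).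
Qed.

Lemma proj_star (S : ehresmann_semigroupoid) (e : ehr_proj S) :
  ehr_star (val e) = val e.
Proof. by rewrite -proj_plus -ehr_plusE. Qed.

Lemma proj_opP (S : ehresmann_semigroupoid) (e f g : ehr_proj S) :
  ehr_proj_op e f = Some g <-> ehr_mul (val e) (val f) = Some (val g).
Proof.
rewrite -val_proj_op; split=> [->//|].
by case: ehr_proj_op => //= h [] /val_inj ->.
Qed.

Lemma proj_op_some (S : ehresmann_semigroupoid) (e f : ehr_proj S) (u : S) :
  ehr_mul (val e) (val f) = Some u ->
  exists2 g, ehr_proj_op e f = Some g & val g = u.
Proof.
by rewrite -val_proj_op; case: ehr_proj_op => //= g [<-]; exists g.
Qed.

Lemma proj_opC (S : ehresmann_semigroupoid) (e f : ehr_proj S) :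
  ehr_mul (val e) (val f) = ehr_mul (val f) (val e).
Proof.
rewrite -(proj_plus e) -(proj_plus f).
exact: (zplusC (Some (val e)) (Some (val f))).
Qed.

Lemma proj_local_meet_semilattice (S : ehresmann_semigroupoid) :
  is_local_meet_semilattice (@ehr_proj_op S).
Proof.
split.
- move=> e f g H.
  have [|ef [fg [u []]]] := @mul_semigroupoid S (val e) (val f) (val g).
    case: H => [[[a /proj_opP A] [b /proj_opP B]]
      |[a /proj_opP A [b /proj_opP B]]|[a /proj_opP A [b /proj_opP B]]].
    + by apply: Or31; split; [exists (val a)|exists (val b)].
    + by apply: Or32; exists (val a) => //; exists (val b).
    + by apply: Or33; exists (val a) => //; exists (val b).
  move=> /proj_op_some[a aE <-] /proj_op_some[b bE <-].
  move=> /proj_op_some[c cE <-] /proj_opP dE.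
  by exists a, b, c.
- by move=> e; apply/proj_opP; rewrite -{1}proj_plus mul_plus.
- move=> e f [g efg]; rewrite efg; apply/proj_opP; rewrite proj_opC.
  exact/proj_opP.
Qed.

(** A semigroup is recovered from the meets of projections: [s^* t^+] defined
    makes [s s^* t^+ t = s t] defined. *)
Lemma total_of_proj (S : ehresmann_semigroupoid) :
  total_op (@ehr_proj_op S) -> total_op (@ehr_mul S).
Proof.
move=> tot s t.
have [g /proj_opP /= gE] := tot (SigSub (star_proj s)) (SigSub (plus_proj t)).
have E1 : zstar (Some s) ** zplus (Some t) <> None by rewrite /= gE.
apply/definedP; rewrite -(zstarK (Some s)) -(zplusK (Some t)) -zmulA.
apply: zmul_neq0; last by rewrite zplusK.
by apply: zmul_neq0; first rewrite zstarK.
Qed.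

Lemma total_proj_of_total (S : ehresmann_semigroupoid) :
  total_op (@ehr_mul S) -> total_op (@ehr_proj_op S).
Proof.
move=> tot e f; have [u /proj_op_some[g gE _]] := tot (val e) (val f).
by exists g.
Qed.

(** * The local biordered Ehresmann category of an Ehresmann semigroupoid *)

Lemma cat_compE (S : ehresmann_semigroupoid) (x y z : cat_of S) :
  cat_comp x y = Some z <->
  ehr_star x = ehr_plus y /\ ehr_mul x y = Some z.
Proof.
by rewrite /=; case: asboolP => [D|nD]; split=> // -[].
Qed.

Lemma cat_domE (S : ehresmann_semigroupoid) (x y : cat_of S) :
  cat_dom x = cat_dom y <-> ehr_star x = ehr_star y.
Proof. by split=> [/(congr1 val)//|E]; apply: val_inj. Qed.

Lemma cat_codE (S : ehresmann_semigroupoid) (x y : cat_of S) :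
  cat_cod x = cat_cod y <-> ehr_plus x = ehr_plus y.
Proof. by split=> [/(congr1 val)//|E]; apply: val_inj. Qed.

(** If [x^* = y^+], then [x x^* = x] and [y^+ y = y] overlap, which makes
    [x y] defined. *)
Lemma mul_of_star_plus (S : ehresmann_semigroupoid) (x y : S) :
  ehr_star x = ehr_plus y -> exists z, ehr_mul x y = Some z.
Proof.
move=> D; apply/definedP; rewrite -(zstarK (Some x)).
by apply: zmul_neq0; rewrite ?zstarK //= D mul_plus.
Qed.

Lemma plus_mul_cod (S : ehresmann_semigroupoid) (x y z : S) :
  ehr_star x = ehr_plus y -> ehr_mul x y = Some z -> ehr_plus z = ehr_plus x.
Proof.
move=> D zE; apply: Some_inj.
have {}D : zstar (Some x) = zplus (Some y) by rewrite /= D.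
have {}zE : Some x ** Some y = Some z := zE.
have : zplus (Some z) = zplus (Some x) by rewrite -zE zplus_mul -D zstarK.
by [].
Qed.

Lemma star_mul_dom (S : ehresmann_semigroupoid) (x y z : S) :
  ehr_star x = ehr_plus y -> ehr_mul x y = Some z -> ehr_star z = ehr_star y.
Proof. by move=> D; apply: (@plus_mul_cod (dual S)). Qed.

Lemma cat_of_category (S : ehresmann_semigroupoid) : is_category (cat_of S).
Proof.
split.
- move=> x y; split=> [[z /cat_compE[D _]]|/(congr1 val) /= D].
    exact: val_inj.
  by have [z zE] := mul_of_star_plus D; exists z; apply/cat_compE.
- by move=> x y z /cat_compE[D zE]; apply/cat_domE/(star_mul_dom D zE).
- by move=> x y z /cat_compE[D zE]; apply/cat_codE/(plus_mul_cod D zE).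
- move=> x y z xy yz /cat_compE[D xyE] /cat_compE[D' yzE] /=.
  rewrite (star_mul_dom D xyE) (plus_mul_cod D' yzE) D D'.
  rewrite !asboolT //.
  have := @zmulA S (Some x) (Some y) (Some z).
  by rewrite /= xyE yzE.
- by move=> e; apply: val_inj; exact: proj_star.
- by move=> e; apply: val_inj; exact: proj_plus.
- move=> x e /(congr1 val) /= D; apply/cat_compE.
  by rewrite proj_plus -D mul_star.
- move=> x e /(congr1 val) /= D; apply/cat_compE.
  by rewrite proj_star -D mul_plus.
Qed.

Lemma lel_ordered_category (S : ehresmann_semigroupoid) :
  is_ordered_category (@cat_lel S).
Proof.
split; [exact: cat_of_category|exact: lel_partial_order|..].
- exact: lel_star_le.
- exact: lel_plus.
- move=> x y x' y' z w xy x'y' /cat_compE[D zE] /cat_compE[_ wE].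
  exact: lel_comp xy x'y' D zE wE.
Qed.

Lemma ler_ordered_category (S : ehresmann_semigroupoid) :
  is_ordered_category (@cat_ler S).
Proof.
split; [exact: cat_of_category|exact: (@lel_partial_order (dual S))|..].
- exact: (@lel_plus (dual S)).
- exact: (@lel_star_le (dual S)).
- move=> x y x' y' z w xy x'y' /cat_compE[D zE] /cat_compE[_ wE].
  exact: (@lel_comp (dual S) _ _ _ _ _ _ x'y' xy (esym D) zE wE).
Qed.

Lemma lel_has_corestrictions (S : ehresmann_semigroupoid) :
  has_corestrictions (@cat_lel S).
Proof.
move=> x e; rewrite /cat_lel /= proj_plus => ex.
have [z [_ zx pz]] := lel_corestriction (proj_plus e) ex.
exists z; split=> [|z' [z'x /(congr1 val) /= z'e]].
  by split=> //; exact: val_inj.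
by apply: lel_corestriction_uniq zx z'x _; rewrite pz z'e.
Qed.

Lemma ler_has_restrictions (S : ehresmann_semigroupoid) :
  has_restrictions (@cat_ler S).
Proof.
move=> x e; rewrite /cat_ler /= proj_star => ex.
have [z [_ zx pz]] := @lel_corestriction (dual S) _ _ (proj_star e) ex.
exists z; split=> [|z' [z'x /(congr1 val) /= z'e]].
  by split=> //; exact: val_inj.
exact: (@lel_corestriction_uniq (dual S) _ _ _ zx z'x (etrans pz (esym z'e))).
Qed.

Lemma local_biordered (S : ehresmann_semigroupoid) :
  is_local_biordered_ehresmann_category
    (@cat_lel S) (@cat_ler S) (@cat_meet S).
Proof.
split.
- exact: lel_ordered_category.
- exact: lel_has_corestrictions.
- exact: ler_ordered_category.
- exact: ler_has_restrictions.
- exact: proj_local_meet_semilattice.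
- move=> e f; rewrite /lms_le /cat_lel proj_plus.
  by split=> /proj_opP.
- move=> e f; rewrite /lms_le /cat_ler proj_star -proj_opC.
  by split=> /proj_opP.
- move=> x y; split; first exact: lel_ler_comm.
  exact: (@lel_ler_comm (dual S)).
- move=> x y e d xy /proj_opP dE.
  have [d' [x' [y' [d'E [x'x x'd] [y'y y'd] x'y']]]] :=
    lel_meet (proj_star e) xy dE.
  exists (@cat_dom (cat_of S) y'), x', y'; split=> //.
    by apply/proj_opP; rewrite /= y'd.
  by split=> //; exact: val_inj.
- move=> x y e d xy /proj_opP dE.
  have [d' [x' [y' [d'E [x'x x'd] [y'y y'd] x'y']]]] :=
    @lel_meet (dual S) _ _ _ _ (proj_plus e) xy dE.
  exists (@cat_cod (cat_of S) y'), x', y'; split=> //.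
    by apply/proj_opP; apply: (etrans d'E); congr Some.
  by split=> //; exact: val_inj.
Qed.

Theorem proposition3p15 (S : ehresmann_semigroupoid) :
  (is_semigroup (@ehr_mul S) <-> is_meet_semilattice (@ehr_proj_op S)) /\
  (is_meet_semilattice (@ehr_proj_op S) <->
   is_biordered_ehresmann_category (@cat_lel S) (@cat_ler S) (@cat_meet S)).
Proof.
have lms := @proj_local_meet_semilattice S; have lbe := @local_biordered S.
split; last by split=> [|[]].
split=> [[_ tot]|[_ [_ tot]]]; last first.
  by split; [exact: mul_semigroupoid|exact: total_of_proj].
split=> //; split; [exact: lms_semigroupoid|exact: total_proj_of_total].
Qed.
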